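(* Let $d\geq 2$ and $p\in(0,1)$ be fixed, and for each $n\geq 1$ let $\{\mathcal{C}_x\}_{x\in\Lambda_n}$ be a collection of constraining neighborhoods on $\Lambda_n=[1,n]^d\cap\mathbb{Z}^d$, with associated oriented kinetically constrained spin model with generator $\mathcal{L}_n$, spectral gap $\lambda^{(n)}$ and mixing time $T_{\rm mix}^{(n)}$. Assume that $\inf_n \lambda^{(n)}>0$. Then there exist constants $C,C'>0$ independent of $n$ such that for all $n\geq 2$ $$C\,n\leq T_{\rm mix}^{(n)}\leq C'\,n\log n.$$
   Context: Fix $d\ge 2$, $p\in(0,1)$ and $q=1-p$. Let $\Lambda_n=([1,n]\times\cdots\times[1,n])\cap\mathbb{Z}^d$ (so $|\Lambda_n|=n^d$), let $\mathbf{e}_1,\dots,\mathbf{e}_d$ be the standard basis vectors, and let $\Omega_n=\{0,1\}^{\Lambda_n}$, with $\sigma_x$ denoting the spin of $\sigma\in\Omega_n$ at $x$. Let $\pi=\prod_{x\in\Lambda_n}\pi_x$ be the product measure on $\Omega_n$, where each $\pi_x$ is Bernoulli$(p)$ (so spin $1$ has probability $p$ and spin $0$ has probability $q$). Constraints. For $x\in\Lambda_n$ let $$\mathcal{K}_x^*=\Big\{y\in\mathbb{Z}^d: y=x-\sum_{i=1}^d\alpha_i\mathbf{e}_i,\ \alpha_i\in\{0,1\}\Big\}\setminus\{x\},$$ and let $x_*=(1,\dots,1)$. A collection of constraining neighborhoods is a family $\{\mathcal{C}_x\}_{x\in\Lambda_n}$ with $\mathcal{C}_{x_*}=\emptyset$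 and $\emptyset\neq\mathcal{C}_x\subset\mathcal{K}_x^*\cap\Lambda_n$ for every $x\neq x_*$. Define $c_x(\sigma)=\prod_{y\in\mathcal{C}_x}(1-\sigma_y)$ if $x\ne x_*$ and $c_{x_*}(\sigma)=1$. The constraint at $x$ is satisfied by $\sigma$ if $c_x(\sigma)=1$. Process. The associated oriented kinetically constrained spin model is the continuous-time Markov chain on $\Omega_n$ with generator $$\mathcal{L}_n f(\sigma)=\sum_{x\in\Lambda_n}c_x(\sigma)\,[\pi_x(f)-f(\sigma)],$$ where $\pi_x(f)$ denotes the conditional mean $\pi(f\mid\{\sigma_y\}_{y\neq x})$. (Equivalently: each site has an independent rate-one Poisson clock; at each ring at $x$, if $c_x=1$ for the current configuration, the spin at $x$ is replaced by an independent Bernoulli$(p)$ variable, otherwise nothing changes.) This chain is irreducible and reversible with respect to $\pi$. For a probability measure $\nu$ on $\Omega_n$, $\nu_t$ denotes the distribution at time $t$ of the chain with initial distribution $\nu$. Spectral gap. $\lambda^{(n)}$ is the smallest positive eigenvalue of $-\mathcal{L}_n$, i.e. $$\lambda^{(n)}=\inf_{f:\Omega_n\to\mathbb{R},\ f\neq\mathrm{const}}\frac{-\pi(f\mathcal{L}_nf)}{\operatorname{Var}_\pi(f)}.$$ Mixing time. $T_{\rm mix}^{(n)}=\inf\{t>0:\sup_{\nu}\|\nu_t-\pi\|_{\rm TV}\leq 1/4\}$, where the supremum is over all probability measures $\nu$ on $\Omega_n$ and $\|\cdot\|_{\rm TV}$ is the total variation distance. *)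

(* Defs.v *)
(** Oriented kinetically constrained spin models on the box [1, n]^d. *)
From HB Require Import structures.
From mathcomp Require Import all_boot all_order all_algebra.
From mathcomp Require Import all_classical all_reals all_analysis.

Set Implicit Arguments.
Unset Strict Implicit.
Unset Printing Implicit Defensive.

Import Order.TTheory GRing.Theory Num.Theory.
Import numFieldNormedType.Exports.

Local Open Scope classical_set_scope.
Local Open Scope ring_scope.

(** Coordinates are shifted by one: the lattice point (x_1, ..., x_d) of
    [1, n]^d is the function i |-> x_i - 1 with values in {0, ..., n - 1}. *)
Definition site (d n : nat) : finType := {ffun 'I_d -> 'I_n}.

(** [true] is spin 1, [false] is spin 0. *)
Definition config (d n : nat) : finType := {ffun site d n -> bool}.

Definition is_corner (d n : nat) (x : site d n) : bool :=
  [forall i : 'I_d, x i == 0%N :> nat].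

(** The intersection of K_x^* with the box; y = x - \sum_i alpha_i e_i is
    written y + alpha = x to avoid truncated subtraction. *)
Definition Kstar (d n : nat) (x : site d n) : {set site d n} :=
  [set y : site d n | (y != x) &&
     [exists alpha : {ffun 'I_d -> bool},
        [forall i : 'I_d, (y i + alpha i)%N == x i :> nat]]]%SET.

Definition constraining (d n : nat) (C : site d n -> {set site d n}) : Prop :=
  forall x : site d n,
    if is_corner x then C x = finset.set0
    else C x <> finset.set0 /\ C x \subset Kstar x.

Section Model.
Context {R : realType} (p : R) {d n : nat}.

Definition eqm (s : config d n) : R :=
  \prod_(x : site d n) (if s x then p else 1 - p).

Definition mean (f : config d n -> R) : R :=
  \sum_(s : config d n) eqm s * f s.

Definition variance (f : config d n -> R) : R :=
  mean (fun s => (f s - mean f) ^+ 2).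

Definition agree_off (x : site d n) (s t : config d n) : bool :=
  [forall y : site d n, (y != x) ==> (t y == s y)].

Definition cond_mean (x : site d n) (f : config d n -> R) (s : config d n)
    : R :=
  (\sum_(t : config d n | agree_off x s t) eqm t * f t) /
  (\sum_(t : config d n | agree_off x s t) eqm t).

Definition constraint (C : site d n -> {set site d n}) (x : site d n)
    (s : config d n) : R :=
  if is_corner x then 1 else \prod_(y in C x) (1 - (s y)%:R).

Definition generator (C : site d n -> {set site d n}) (f : config d n -> R)
    (s : config d n) : R :=
  \sum_(x : site d n) constraint C x s * (cond_mean x f s - f s).

(** Here and below, [inf] and [sup] are real-valued and equal 0 on empty or
    unbounded sets; for 0 < p < 1, n >= 1 and constraining C all the sets
    involved are nonempty and bounded on the relevant side. *)
Definition spectral_gap (C : site d n -> {set site d n}) : R :=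
  inf [set r : R | exists f : config d n -> R,
    (exists s t, f s <> f t) /\
    r = - mean (fun s => f s * generator C f s) / variance f].

(** The Markov semigroup e^{tL} = \sum_k t^k / k! L^k; the series converges
    because the state space is finite. *)
Definition semigroup (C : site d n -> {set site d n}) (t : R)
    (f : config d n -> R) (s : config d n) : R :=
  limn (series (fun k : nat => exp_coeff t k * iter k (generator C) f s)).

Definition is_prob (nu : config d n -> R) : Prop :=
  (forall s, 0 <= nu s) /\ \sum_(s : config d n) nu s = 1.

(** Distribution nu_t at time t of the chain with initial distribution nu:
    nu_t (s) = \sum_u nu(u) (e^{tL} 1_{s})(u). *)
Definition law_at (C : site d n -> {set site d n}) (t : R)
    (nu : config d n -> R) (s : config d n) : R :=
  \sum_(u : config d n) nu u * semigroup C t (fun v => (v == s)%:R) u.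

Definition tv_dist (mu nu : config d n -> R) : R :=
  \big[Num.max/0]_(A : {set config d n})
    `| \sum_(s in A) mu s - \sum_(s in A) nu s |.

Definition worst_tv (C : site d n -> {set site d n}) (t : R) : R :=
  sup [set r : R | exists nu : config d n -> R,
    is_prob nu /\ r = tv_dist (law_at C t nu) eqm].

Definition mixing_time (C : site d n -> {set site d n}) : R :=
  inf [set t : R | 0 < t /\ worst_tv C t <= 1 / 4].

End Model.

(* Main.v *)
(** Upper bound.  Constraints point to strictly lower levels (coordinate sums),
    so functions of the levels below [k] are preserved by the semigroup.  If [f]
    depends on the levels up to [k], telescoping over the sites [x] of level [k]
    compares [P tau f] with [P tau] of the average of [f] over that level; the
    error at [x] is at most the probability that [x] has no legal ring before
    [tau].  The latter is a function of the levels below [k], and its mean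
    decays like [exp (- rate * tau)] by Feynman-Kac and the spectral gap.  With
    [tau] of order [ln n] the at most [d * n] levels each cost a polynomially
    small error.

    Lower bound.  For [y] in [C x], [L (1 - s_x) <= 1 - s_y], so started from
    all ones, [P t (1 - s_x) <= t ^ j / j!] whenever some coordinate of [x] is
    at least [j]: up to time [n / 64], [n] given sites with a coordinate [n - 1]
    are all still ones with probability at least [3 / 4].  In equilibrium this
    has probability [p ^ n], which settles the case [p ^ n <= 1 / 4]; the
    finitely many other [n], for which [1 / 2 < p], only require a positive
    lower bound, which the exit time from the all-zero configuration gives. *)
Require Import Defs.
From HB Require Import structures.
From mathcomp Require Import all_boot all_order all_algebra.
From mathcomp Require Import all_classical all_reals all_analysis.
From mathcomp Require Import ring lra zify.
Import Order.TTheory GRing.Theory Num.Theory.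
Import numFieldNormedType.Exports.
Local Open Scope classical_set_scope.
Local Open Scope ring_scope.

Set Implicit Arguments.
Unset Strict Implicit.
Unset Printing Implicit Defensive.

(** * Exponentials of operators on a finite set *)

Section RealDerivatives.
Context {R : realType}.

Lemma is_derive_fin_sum (I : finType) (h : I -> R -> R) (dh : I -> R) (t : R) :
  (forall i, is_derive t (1 : R) (h i) (dh i)) ->
  is_derive t (1 : R) (fun r => \sum_i h i r) (\sum_i dh i).
Proof.
move=> H; have -> : (fun r => \sum_i h i r) = \sum_i h i.
  by apply/funext => r; rewrite fct_sumE.
apply: (big_ind2 (fun f df => is_derive t (1 : R) f df)).
- exact: is_derive_cst.
- by move=> f df g dg Hf Hg; exact: is_deriveD.
- by move=> i _; exact: H.
Qed.

Lemma le_at0_of_derive_le0 (f df : R -> R) (t : R) :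
  (forall r, is_derive r (1 : R) f (df r)) -> 0 <= t ->
  (forall r, 0 <= r <= t -> df r <= 0) -> f t <= f 0.
Proof.
move=> fd t0 dfle.
have [|c ct] := @MVT_segment R f df 0 t t0 (fun x _ => fd x).
- apply: continuous_subspaceT => r.
  apply/differentiable_continuous/derivable1_diffP.
  by case: (fd r).
rewrite subr0 => e; rewrite -subr_le0 e mulr_le0_ge0 //.
by apply: dfle; move: ct; rewrite in_itv.
Qed.

End RealDerivatives.

Section OperatorExponential.
Context {R : realType} {T : finType}.
Implicit Types (A B : (T -> R) -> T -> R) (f g : T -> R) (s u : T) (t : R).

Definition linop A :=
  forall (c : R) f g s, A (fun u => c * f u + g u) s = c * A f s + A g s.

Definition delta_fun u : T -> R := fun s => (s == u)%:R.

(** For [A] the generator this unfolds to the same term as [semigroup], so the results below apply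
    to it directly. *)
Definition opexp A t f s : R :=
  limn (series (fun k : nat => exp_coeff t k * iter k A f s)).

Lemma delta_expand f : f = fun s => \sum_u f u * delta_fun u s.
Proof.
apply/funext => s; rewrite (bigD1 s) //= /delta_fun eqxx mulr1.
by rewrite big1 ?addr0// => u us; rewrite eq_sym (negPf us) mulr0.
Qed.

Section Linear.
Variable A : (T -> R) -> T -> R.
Hypothesis linA : linop A.

Lemma linop0 s : A (fun=> 0) s = 0.
Proof.
have := linA (-1) (fun=> 0) (fun=> 0) s.
rewrite (_ : (fun u : T => -1 * 0 + 0 : R) = fun=> 0); last first.
  by apply/funext => u; rewrite mulr0 addr0.
by rewrite mulN1r addNr.
Qed.

Lemma linop_scale c f s : A (fun u => c * f u) s = c * A f s.
Proof.
have := linA c f (fun=> 0) s; rewrite linop0 addr0 => <-.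
by congr (A _ s); apply/funext => u; rewrite addr0.
Qed.

Lemma linop_sub f g s : A (fun u => f u - g u) s = A f s - A g s.
Proof.
have := linA (-1) g f s; rewrite mulN1r addrC => <-.
by congr (A _ s); apply/funext => u; rewrite mulN1r addrC.
Qed.

Lemma linop_sum (I : finType) (c : I -> R) (F : I -> T -> R) s :
  A (fun u => \sum_i c i * F i u) s = \sum_i c i * A (F i) s.
Proof.
elim: (index_enum I) => [|i r IH].
  rewrite big_nil -[RHS](linop0 s); congr (A _ s).
  by apply/funext => u; rewrite big_nil.
rewrite big_cons -IH -linA; congr (A _ s); apply/funext => u.
by rewrite big_cons.
Qed.

Lemma linop_kernel f s : A f s = \sum_u f u * A (delta_fun u) s.
Proof. by rewrite {1}(delta_expand f) linop_sum. Qed.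

Lemma linop_iter k : linop (iter k A).
Proof.
elim: k => [|k IH] c f g s //=.
rewrite -linA; congr (A _ s); apply/funext => u; exact: IH.
Qed.

(** [M] adds the absolute values of all matrix entries, hence dominates every row sum; [K] dominates
    [f] pointwise. *)
Lemma iter_linop_bounded f : exists M K : R, [/\ 0 <= M, 0 <= K &
  forall k s, `|iter k A f s| <= M ^+ k * K].
Proof.
exists (\sum_s \sum_u `|A (delta_fun u) s|), (\sum_u `|f u|).
split; [by do 2?apply: sumr_ge0 => ? _|by apply: sumr_ge0|].
elim=> [|k IH] s /=.
  by rewrite mul1r (bigD1 s) //= lerDl sumr_ge0.
rewrite linop_kernel exprS -mulrA.
apply: (le_trans (ler_norm_sum _ _ _)).
set K := _ ^+ k * _ in IH *.
have K0 : 0 <= K by exact: le_trans (IH s).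
apply: (@le_trans _ _ (\sum_u K * `|A (delta_fun u) s|)).
  by apply: ler_sum => u _; rewrite normrM ler_wpM2r.
rewrite -mulr_sumr mulrC ler_wpM2r//.
by rewrite [leRHS](bigD1 s)//= lerDl sumr_ge0// => ? _; exact: sumr_ge0.
Qed.

Lemma opexp_series_cvg t f s :
  cvgn (series (fun k : nat => exp_coeff t k * iter k A f s)).
Proof.
have [M [K [M0 K0 MK]]] := iter_linop_bounded f.
apply: normed_cvg.
apply: (@series_le_cvg _ _ (fun k => K * exp_coeff (`|t| * M) k)) => //.
- by move=> n /=.
- by move=> n; apply: mulr_ge0 => //; apply: exp_coeff_ge0; exact: mulr_ge0.
- move=> n /=; rewrite /exp_coeff /= !normrM normrX exprMn normfV normr_nat.
  have -> : K * (`|t| ^+ n * M ^+ n / n`!%:R) =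
    `|t| ^+ n / n`!%:R * (M ^+ n * K) by ring.
  by rewrite ler_wpM2l// divr_ge0// exprn_ge0.
- rewrite (_ : series _ = series (K *: exp_coeff (`|t| * M))).
    exact/is_cvg_seriesZ/is_cvg_series_exp_coeff.
  by [].
Qed.

Lemma opexp_cvg t f s :
  series (fun k : nat => exp_coeff t k * iter k A f s) @ \oo --> opexp A t f s.
Proof. exact: opexp_series_cvg. Qed.

(** With [w] a row of the matrix of [A], this is what makes [A] commute with its exponential. *)
Lemma sum_opexp (w : T -> R) t f :
  series (fun k : nat => exp_coeff t k * \sum_s w s * iter k A f s) @ \oo -->
  \sum_s w s * opexp A t f s.
Proof.
rewrite (_ : series _ = fun n => \sum_s w s *
    series (fun k : nat => exp_coeff t k * iter k A f s) n); last first.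
  apply/funext => n; rewrite /series /=.
  under eq_bigr => k _ do rewrite mulr_sumr.
  rewrite exchange_big /=; apply: eq_bigr => s _.
  by rewrite mulr_sumr; apply: eq_bigr => k _; rewrite mulrCA.
elim: (index_enum T) => [|s r IH].
  rewrite big_nil (_ : (fun n => _) = cst 0); first exact: cvg_cst.
  by apply/funext => n; rewrite big_nil.
under eq_fun => n do rewrite big_cons.
rewrite big_cons; apply: cvgD IH; apply: cvgMl_tmp; exact: opexp_cvg.
Qed.

Lemma opexp_linop t : linop (opexp A t).
Proof.
move=> c f g s; apply: cvg_lim => //.
rewrite (_ : series _ = fun n =>
   c * series (fun k : nat => exp_coeff t k * iter k A f s) n +
   series (fun k : nat => exp_coeff t k * iter k A g s) n); last first.
  apply/funext => n; rewrite /series /= mulr_sumr -big_split /=.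
  apply: eq_bigr => k _; rewrite linop_iter mulrDr; congr (_ + _).
  by rewrite mulrCA.
by apply: cvgD; [apply: cvgMl_tmp|]; exact: opexp_cvg.
Qed.

Lemma opexp_comm t f s : A (opexp A t f) s = opexp A t (A f) s.
Proof.
apply/esym/cvg_lim => //; rewrite linop_kernel.
under eq_bigr => u _ do rewrite mulrC.
rewrite (_ : (fun k : nat => _) = fun k : nat =>
    exp_coeff t k * \sum_u A (delta_fun u) s * iter k A f u).
  exact: sum_opexp.
apply/funext => k; rewrite -iterSr /= (linop_kernel _ s); congr (_ * _).
by apply: eq_bigr => u _; rewrite mulrC.
Qed.

Lemma opexp_time0 f s : opexp A 0 f s = f s.
Proof.
apply: lim_near_cst => //; near=> m.
rewrite -[m]prednK; last by near: m; exact: nbhs_infty_gt.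
rewrite /series /= big_nat_recl //= /exp_coeff /= expr0 fact0 divr1 mul1r.
by rewrite big1 ?addr0// => i _; rewrite expr0n /= mul0r mul0r.
Unshelve. all: by end_near. Qed.

(** As a power series in [t], formal differentiation shifts the index [k], which amounts to
    replacing [f] by [A f]. *)
Lemma opexp_derive t f s :
  is_derive t (1 : R) (fun r => opexp A r f s) (opexp A t (A f) s).
Proof.
pose a g (k : nat) : R := iter k A g s / k`!%:R.
have aE r g : (fun k : nat => exp_coeff r k * iter k A g s) =
              (fun k : nat => a g k * r ^+ k).
  by apply/funext => k; rewrite /exp_coeff /= /a mulrC mulrA mulrAC.
have da g : pseries_diffs (a g) = a (A g).
  apply/funext => k; rewrite /pseries_diffs /a -iterSr factS natrM invfM.
  by rewrite mulrCA mulVKf// pnatr_eq0.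
have cva g r : cvgn (pseries (a g) r).
  by rewrite /pseries -aE; exact: opexp_series_cvg.
have -> : (fun r => opexp A r f s) = fun r => limn (pseries (a f) r).
  by apply/funext => r; rewrite /opexp aE.
have -> : opexp A t (A f) s = limn (pseries (pseries_diffs (a f)) t).
  by rewrite /opexp aE da.
apply: (@pseries_snd_diffs _ _ (`|t| + 1)); rewrite ?da //.
by rewrite [ltRHS]ger0_norm ?ltrDl // addr_ge0.
Qed.

End Linear.

(** Duhamel interpolation: [opexp A (t - r) (u r) s] is constant in [r], and its values at [r = t]
    and [r = 0] are the two sides. Expanding in point masses reduces its derivative to the product
    rule. *)
Lemma opexp_unique A (u : R -> T -> R) : linop A ->
  (forall t s, is_derive t (1 : R) (fun r => u r s) (A (u t) s)) ->
  forall t s, u t s = opexp A t (u 0) s.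
Proof.
move=> linA du t s.
pose v (r : R) : R := \sum_z u r z * opexp A (t - r) (delta_fun z) s.
have vE r : v r = opexp A (t - r) (u r) s.
  by rewrite /v [in RHS](delta_expand (u r)) (linop_sum (opexp_linop linA _)).
have : v t = v 0.
  apply: is_derive_0_is_cst => r.
  pose w z := A (u r) z * opexp A (t - r) (delta_fun z) s -
              u r z * opexp A (t - r) (A (delta_fun z)) s.
  have <- : \sum_z w z = 0.
    rewrite /w sumrB -(linop_sum (opexp_linop linA _)) -delta_expand.
    rewrite -(linop_sum (opexp_linop linA _)).
    apply/eqP; rewrite subr_eq0; apply/eqP; congr (opexp A _ _ s).
    by apply/funext => z; exact: (linop_kernel linA).
  apply: is_derive_fin_sum => z.
  have dE : is_derive r (1 : R) (fun r => opexp A (t - r) (delta_fun z) s)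
      (- opexp A (t - r) (A (delta_fun z)) s).
    have db : is_derive r (1 : R) (fun r : R => t - r) (-1).
      by apply: is_derive_eq; ring.
    have := @is_derive1_comp R (fun x => opexp A x (delta_fun z) s)
      (fun x => t - x) r _ _ (opexp_derive linA (t - r) (delta_fun z) s) db.
    by rewrite mulrN1.
  apply: is_derive_eq; rewrite /w /GRing.scale /=.
  by ring.
by rewrite !vE subrr opexp_time0 subr0.
Qed.

(** As functions of [t], both sides solve the same linear equation with the same value at 0. *)
Lemma opexp_add A t r f s : linop A ->
  opexp A (t + r) f s = opexp A t (opexp A r f) s.
Proof.
move=> linA.
pose u x := opexp A (x + r) f.
have -> : opexp A r f = u 0 by rewrite /u add0r.
suff du x z : is_derive x (1 : R) (u ^~ z) (A (u x) z).
  by rewrite -(opexp_unique linA du).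
rewrite /u opexp_comm//.
have dx : is_derive x (1 : R) (fun y : R => y + r) 1.
  by apply: is_derive_eq; ring.
have := @is_derive1_comp R (fun y => opexp A y f z) (fun y => y + r) x _ _
  (opexp_derive linA (x + r) f z) dx.
by rewrite mulr1.
Qed.

Lemma opexp_fix A t f s : (forall u, A f u = 0) -> linop A ->
  opexp A t f s = f s.
Proof.
move=> Af0 linA; apply/esym.
apply: (@opexp_unique A (fun=> f) linA) => x z.
by rewrite Af0; exact: is_derive_cst.
Qed.

Lemma opexp_invariant A (w : T -> R) t f : linop A ->
  (forall g, \sum_s w s * A g s = 0) ->
  \sum_s w s * opexp A t f s = \sum_s w s * f s.
Proof.
move=> linA wA.
have d r : is_derive r (1 : R) (fun r => \sum_s w s * opexp A r f s) 0.
  suff : is_derive r (1 : R) (fun r => \sum_s w s * opexp A r f s)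
      (\sum_s w s * A (opexp A r f) s) by rewrite wA.
  apply: is_derive_fin_sum => z.
  rewrite opexp_comm//; have dz := opexp_derive linA r f z.
  by apply: is_derive_eq; rewrite /GRing.scale /= ; ring.
rewrite (is_derive_0_is_cst t 0 d).
by apply: eq_bigr => z _; rewrite opexp_time0.
Qed.

(* exp(tA) = exp(-Nt) exp(t(A + N)), and the series of exp(t(A + N)) f has
   nonnegative terms, the first of which is f. *)
Lemma opexp_lower_bound A (N : R) t f s : linop A ->
  (forall g, (forall u, 0 <= g u) -> forall u, 0 <= A g u + N * g u) ->
  0 <= t -> (forall u, 0 <= f u) -> expR (- (N * t)) * f s <= opexp A t f s.
Proof.
move=> linA posA t0 f0.
pose B g u := A g u + N * g u.
have linB : linop B by move=> c g h u; rewrite /B linA; ring.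
have -> : opexp A t f s = expR (- (N * t)) * opexp B t f s.
  pose u x z := expR (N * x) * opexp A x f z.
  have u0 : u 0 = f.
    by apply/funext => z; rewrite /u mulr0 expR0 mul1r opexp_time0.
  suff du x z : is_derive x (1 : R) (u ^~ z) (B (u x) z).
    rewrite -[f in RHS]u0 -(opexp_unique linB du) /u mulrA -expRD addNr.
    by rewrite expR0 mul1r.
  rewrite /B /u linop_scale// opexp_comm//.
  have dA := opexp_derive linA x f z.
  have dN : is_derive x (1 : R) (fun y : R => N * y) N.
    by apply: is_derive_eq; rewrite /GRing.scale /=; ring.
  have dE : is_derive x (1 : R) (fun y => expR (N * y)) (expR (N * x) * N).
    exact: (@is_derive1_comp R expR (fun y => N * y) x _ _
      (is_derive_expR (N * x)) dN).
  apply: is_derive_eq.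
  by rewrite /GRing.scale /=; ring.
rewrite ler_wpM2l ?expR_ge0//.
have itB k z : 0 <= iter k B f z.
  by elim: k z => [|k IH] z //=; exact: posA.
apply: limr_ge; first exact: opexp_series_cvg.
near=> m; rewrite -[m]prednK; last by near: m; exact: nbhs_infty_gt.
rewrite /series /= big_nat_recl //= /exp_coeff /= expr0 fact0 divr1 mul1r.
rewrite lerDl; apply: sumr_ge0 => i _; apply: mulr_ge0.
  by rewrite divr_ge0// exprn_ge0.
exact: (itB i.+1).
Unshelve. all: by end_near. Qed.

Lemma opexp_ge0 A (N : R) t f s : linop A ->
  (forall g, (forall u, 0 <= g u) -> forall u, 0 <= A g u + N * g u) ->
  0 <= t -> (forall u, 0 <= f u) -> 0 <= opexp A t f s.
Proof.
move=> linA posA t0 f0; apply: le_trans (opexp_lower_bound s linA posA t0 f0).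
by rewrite mulr_ge0 // expR_ge0.
Qed.

Lemma opexp_le A (N : R) t f g s : linop A ->
  (forall g, (forall u, 0 <= g u) -> forall u, 0 <= A g u + N * g u) ->
  0 <= t -> (forall u, f u <= g u) -> opexp A t f s <= opexp A t g s.
Proof.
move=> linA posA t0 fg; rewrite -subr_ge0 -(linop_sub (opexp_linop linA t)).
by apply: (opexp_ge0 s linA posA t0) => u; rewrite subr_ge0.
Qed.

End OperatorExponential.

(** * The product measure and single-site resampling *)

Section Resampling.
Context {R : realType} {p : R} {d n : nat}.
Hypotheses (p0 : 0 < p) (p1 : p < 1).
Implicit Types (x y z : site d n) (s t : config d n) (f g c : config d n -> R).

Definition upd s x (b : bool) : config d n :=
  [ffun y => if y == x then b else s y].

Definition resample x f s : R :=
  p * f (upd s x true) + (1 - p) * f (upd s x false).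

Definition indep_of x f := forall s b, f (upd s x b) = f s.

Lemma updE s x b y : upd s x b y = if y == x then b else s y.
Proof. by rewrite ffunE. Qed.

Lemma upd_upd s x b b' : upd (upd s x b) x b' = upd s x b'.
Proof. by apply/ffunP => y; rewrite !updE; case: eqP. Qed.

Lemma upd_comm s x y b b' : x != y ->
  upd (upd s x b) y b' = upd (upd s y b') x b.
Proof.
move=> xy; apply/ffunP => z; rewrite !updE.
by have [->|//] := eqVneq z y; rewrite eq_sym (negPf xy).
Qed.

Lemma upd_same s x : upd s x (s x) = s.
Proof. by apply/ffunP => y; rewrite updE; case: eqP => [->|]. Qed.

Lemma resample_indep x f : indep_of x (resample x f).
Proof. by move=> s b; rewrite /resample !upd_upd. Qed.

Lemma resample_id x f s : indep_of x f -> resample x f s = f s.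
Proof. by move=> fx; rewrite /resample !fx -mulrDl addrC subrK mul1r. Qed.

Lemma resample_linear x : linop (resample x : (config d n -> R) -> _).
Proof. by move=> c f g s; rewrite /resample; ring. Qed.

Lemma resample_mull x c f s : indep_of x c ->
  resample x (fun s => c s * f s) s = c s * resample x f s.
Proof. by move=> cx; rewrite /resample !cx; ring. Qed.

Lemma resample_ge0 x f s : (forall s, 0 <= f s) -> 0 <= resample x f s.
Proof.
by move=> f0; apply: addr_ge0; apply: mulr_ge0; rewrite // ?subr_ge0 ltW.
Qed.

Lemma resample_le1 x f s : (forall s, f s <= 1) -> resample x f s <= 1.
Proof.
move=> f1; have := f1 (upd s x true); have := f1 (upd s x false).
rewrite /resample => a b.
have q0 : 0 <= 1 - p by rewrite subr_ge0 ltW.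
have /= := ler_wpM2l (ltW p0) b; have /= := ler_wpM2l q0 a.
lra.
Qed.

Lemma resample_comm x y f s :
  resample x (resample y f) s = resample y (resample x f) s.
Proof.
have [->//|xy] := eqVneq x y; rewrite /resample.
by rewrite !(upd_comm _ _ _ xy); ring.
Qed.

Lemma indep_resample x y f : indep_of y f -> indep_of y (resample x f).
Proof.
have [->|xy] := eqVneq x y; first by move=> *; exact: resample_indep.
by move=> fy s b; rewrite /resample !(upd_comm _ _ _ (_ : y != x)) ?fy// eq_sym.
Qed.

Lemma eqm_upd s x b : eqm p (upd s x b) =
  (if b then p else 1 - p) * \prod_(y | y != x) (if s y then p else 1 - p).
Proof.
rewrite /eqm (bigD1 x) //= updE eqxx; congr (_ * _).
by apply: eq_bigr => y yx; rewrite updE (negPf yx).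
Qed.

Lemma eqm_gt0 s : 0 < eqm p s.
Proof. by apply: prodr_gt0 => x _; case: ifP; rewrite ?subr_gt0. Qed.

Lemma agree_off_sum x s (F : config d n -> R) :
  \sum_(t | agree_off x s t) F t = F (upd s x true) + F (upd s x false).
Proof.
have ag b : agree_off x s (upd s x b).
  by apply/forallP => y; apply/implyP => yx; rewrite updE (negPf yx).
rewrite (bigD1 (upd s x true)) //= (bigD1 (upd s x false)) /=; last first.
  rewrite ag; apply/eqP => /ffunP /(_ x).
  by rewrite !updE eqxx.
rewrite big1 ?addr0// => t /andP[/andP[/forallP agt tT] tF].
suff e : t = upd s x (t x) by case: (t x) e tT tF => ->; rewrite eqxx.
apply/ffunP => y; rewrite updE; case: eqVneq => [->//|yx].
by have := agt y; rewrite yx => /eqP.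
Qed.

Lemma cond_meanE x f : cond_mean p x f = resample x f.
Proof.
apply/funext => s; rewrite /cond_mean !agree_off_sum !eqm_upd /resample.
set w := \prod_(y | _) _.
have w0 : w != 0.
  rewrite gt_eqF //; apply: prodr_gt0 => y _; case: ifP => _ //.
  by rewrite subr_gt0.
by field; rewrite -mulrDl addrC subrK mul1r.
Qed.

Lemma meanZ (c : R) f : mean p (fun s => c * f s) = c * mean p f.
Proof. by rewrite /mean mulr_sumr; apply: eq_bigr => s _; ring. Qed.

Lemma meanD f g : mean p (fun s => f s + g s) = mean p f + mean p g.
Proof. by rewrite /mean -big_split /=; apply: eq_bigr => s _; ring. Qed.

Lemma meanB f g : mean p (fun s => f s - g s) = mean p f - mean p g.
Proof. by rewrite /mean -sumrB /=; apply: eq_bigr => s _; ring. Qed.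

Lemma mean_sum (I : Type) (r : seq I) (F : I -> config d n -> R) :
  mean p (fun s => \sum_(i <- r) F i s) = \sum_(i <- r) mean p (F i).
Proof.
rewrite /mean exchange_big /=; apply: eq_bigr => s _.
by rewrite mulr_sumr.
Qed.

Lemma mean_ge0 f : (forall s, 0 <= f s) -> 0 <= mean p f.
Proof.
by move=> f0; apply: sumr_ge0 => s _; rewrite mulr_ge0// ltW// eqm_gt0.
Qed.

Lemma mean_le f g : (forall s, f s <= g s) -> mean p f <= mean p g.
Proof.
by move=> fg; rewrite -subr_ge0 -meanB mean_ge0// => s; rewrite subr_ge0.
Qed.

Lemma mean_prod (F : site d n -> bool -> R) :
  mean p (fun s => \prod_x F x (s x)) =
  \prod_x (p * F x true + (1 - p) * F x false).
Proof.
pose G x b := (if b then p else 1 - p) * F x b.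
have -> : \prod_x (p * F x true + (1 - p) * F x false) =
          \prod_x \sum_(b : bool) G x b.
  by apply: eq_bigr => x _; rewrite big_bool.
rewrite bigA_distr_bigA /=; apply: eq_bigr => s _.
by rewrite /eqm -big_split.
Qed.

Lemma mean_prod_in (X : {set site d n}) (phi : bool -> R) :
  mean p (fun s => \prod_(x in X) phi (s x)) =
  (p * phi true + (1 - p) * phi false) ^+ #|X|.
Proof.
have -> : (fun s => \prod_(x in X) phi (s x)) =
    fun s : config d n => \prod_x (if x \in X then phi (s x) else 1).
  by apply/funext => s; rewrite big_mkcond.
rewrite (mean_prod (fun x b => if x \in X then phi b else 1)).
rewrite -prodr_const [RHS]big_mkcond; apply: eq_bigr => x _.
by case: ifP => // _; ring.
Qed.

Lemma mean_cst (a : R) : mean p (fun _ : config d n => a) = a.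
Proof.
have := mean_prod_in finset.set0 (fun=> 1); rewrite cards0 expr0 => e.
rewrite -[RHS]mulr1 -e -meanZ; congr mean; apply/funext => s.
by rewrite big_set0 mulr1.
Qed.

Lemma mean_resample x f : mean p (resample x f) = mean p f.
Proof.
pose fl s := upd s x (~~ s x).
have flK : involutive fl.
  move=> s; apply/ffunP => y; rewrite !updE eqxx.
  by case: eqVneq => [->|//]; rewrite negbK.
(* Flipping the spin at [x] permutes the configurations, so it is convenient to compare the doubled
   means. *)
have S2 (F : config d n -> R) : \sum_s F s + \sum_s F s =
    \sum_s (F (upd s x true) + F (upd s x false)).
  have e : \sum_s F s = \sum_s F (fl s) by rewrite (reindex_inj (inv_inj flK)).
  rewrite {2}e -big_split /=; apply: eq_bigr => s _.
  have := upd_same s x; rewrite /fl.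
  by case: (s x) => /= us; rewrite -[in F s]us // addrC.
suff : mean p (resample x f) + mean p (resample x f) = mean p f + mean p f.
  by move=> e; lra.
rewrite /mean !S2; apply: eq_bigr => s _.
by rewrite !resample_indep !eqm_upd /resample; ring.
Qed.

Lemma mean_indep_mul x c f : indep_of x c ->
  mean p (fun s => c s * resample x f s) = mean p (fun s => c s * f s).
Proof.
move=> cx; rewrite -[RHS](mean_resample x); congr mean.
by apply/funext => s; rewrite resample_mull.
Qed.

Lemma varianceE f :
  Defs.variance p f = mean p (fun s => f s ^+ 2) - mean p f ^+ 2.
Proof.
rewrite /Defs.variance; set m := mean p f.
rewrite (_ : (fun s => (f s - m) ^+ 2) =
   fun s => f s ^+ 2 + (- (2 * m) * f s + m ^+ 2)); last first.
  by apply/funext => s; ring.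
rewrite meanD meanD meanZ mean_cst -/m; ring.
Qed.

Lemma variance_ge0 f : 0 <= Defs.variance p f.
Proof. by apply: mean_ge0 => s; exact: sqr_ge0. Qed.

End Resampling.

(** * The oriented generator and the killed chain *)

Section OrientedGenerator.
Context {R : realType} {p : R} {d n : nat}.
Hypotheses (p0 : 0 < p) (p1 : p < 1).
Context {C : site d n -> {set site d n}}.
Hypothesis hC : constraining C.
Implicit Types (x y z : site d n) (s t : config d n) (f g : config d n -> R).

Local Notation L := (generator p C).
Local Notation cstr := (constraint (R := R) C).
Local Notation N := (#|site d n|%:R : R).
Local Notation res := (@resample R p d n).

Definition lev x : nat := \sum_i x i.

Definition dep_below k f := forall y, (k <= lev y)%N -> indep_of y f.

Lemma Kstar_lev x y : y \in Kstar x -> (lev y < lev x)%N.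
Proof.
rewrite inE => /andP[yx /existsP[al /forallP yal]].
have e i : (x i = y i + al i :> nat)%N by rewrite (eqP (yal i)).
rewrite /lev (eq_bigr _ (fun i _ => e i)) big_split /= -[X in (X < _)%N]addn0.
rewrite ltn_add2l lt0n; apply: contra yx; rewrite sum_nat_eq0 => /forallP al0.
apply/eqP/ffunP => i; apply/val_inj; rewrite /= e.
by move: (al0 i) => /= /eqP ->; rewrite addn0.
Qed.

Lemma constraint_sub x y : y \in C x -> y \in Kstar x.
Proof.
have := hC x; case: ifP => _; first by move=> ->; rewrite finset.in_set0.
by move=> [_ /fintype.subsetP]; apply.
Qed.

Lemma constraint_indep x y : (lev x <= lev y)%N -> indep_of y (cstr x).
Proof.
move=> xy s b; rewrite /constraint; case: ifP => // _.
apply: eq_bigr => z zC; rewrite updE; case: eqVneq => // zy.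
by have := Kstar_lev (constraint_sub zC); rewrite zy ltnNge xy.
Qed.

Lemma constraint_ge0 x s : 0 <= cstr x s.
Proof.
rewrite /constraint; case: ifP => // _; apply: prodr_ge0 => y _.
by rewrite subr_ge0; case: (s y).
Qed.

Lemma constraint_le1 x s : cstr x s <= 1.
Proof.
rewrite /constraint; case: ifP => // _; apply: prodr_ile1 => y _.
by case: (s y); rewrite /= ?subrr ?subr0 ?lexx ?ler01.
Qed.

Lemma generatorE f s : L f s = \sum_x cstr x s * (res x f s - f s).
Proof.
by rewrite /generator; apply: eq_bigr => x _; rewrite cond_meanE.
Qed.

Lemma generator_linear : linop L.
Proof.
move=> c f g s; rewrite !generatorE mulr_sumr -big_split /=.
by apply: eq_bigr => x _; rewrite resample_linear; ring.
Qed.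

(** Uniformization: each site is resampled with weight [cstr x s] and left alone with the
    complementary weight, which makes [L + N] positivity preserving. *)
Lemma generator_shift f s :
  L f s + N * f s = \sum_x (cstr x s * res x f s + (1 - cstr x s) * f s).
Proof.
rewrite generatorE (_ : N * f s = \sum_(x : site d n) f s); last first.
  by rewrite sumr_const mulr_natl; congr (_ *+ _); exact: eq_card.
by rewrite -big_split /=; apply: eq_bigr => x _; ring.
Qed.

Lemma shift_term_ge0 f s x : (forall s, 0 <= f s) ->
  0 <= cstr x s * res x f s + (1 - cstr x s) * f s.
Proof.
move=> f0; apply: addr_ge0; apply: mulr_ge0 => //.
- exact: constraint_ge0.
- exact: (resample_ge0 p0 p1).
- by rewrite subr_ge0 constraint_le1.
Qed.

Lemma generator_pos f : (forall s, 0 <= f s) -> forall s, 0 <= L f s + N * f s.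
Proof.
move=> f0 s; rewrite generator_shift sumr_ge0// => x _.
exact: shift_term_ge0.
Qed.

(** The constraint at [x] ignores the spin at [x], so resampling that spin does not change the mean
    of [cstr x s * f s]. *)
Lemma mean_generator f : mean p (L f) = 0.
Proof.
have -> : L f = fun s => \sum_x cstr x s * (res x f s - f s).
  by apply/funext => s; exact: generatorE.
rewrite mean_sum big1// => x _.
rewrite (_ : (fun s => _) = fun s => cstr x s * res x f s - cstr x s * f s).
  by rewrite meanB mean_indep_mul ?subrr//; exact: constraint_indep.
by apply/funext => s; ring.
Qed.

(** Averaging over the spin at [x] turns its term into the constraint times a conditional variance,
    [p * (1 - p) * (a - b) ^+ 2]. *)
Lemma dirichlet_ge0 f : 0 <= - mean p (fun s => f s * L f s).
Proof.
rewrite -mulN1r -meanZ.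
rewrite (_ : (fun s => _) = fun s =>
   \sum_x cstr x s * (f s * (f s - res x f s))); last first.
  apply/funext => s; rewrite generatorE mulr_sumr mulr_sumr.
  by apply: eq_bigr => x _; ring.
rewrite mean_sum; apply: sumr_ge0 => x _.
rewrite -(mean_indep_mul (x := x)); last exact: constraint_indep.
apply: mean_ge0 => // s; apply: mulr_ge0; first exact: constraint_ge0.
rewrite /resample !upd_upd.
set a := f _; set b := f _.
have -> : p * (a * (a - (p * a + (1 - p) * b))) +
  (1 - p) * (b * (b - (p * a + (1 - p) * b))) = p * (1 - p) * (a - b) ^+ 2.
  by ring.
by rewrite mulr_ge0 ?sqr_ge0// mulr_ge0 ?ltW// subr_gt0.
Qed.

Lemma opexp_dep (A : (config d n -> R) -> config d n -> R) k (t : R) f :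
  (forall g, dep_below k g -> dep_below k (A g)) ->
  dep_below k f -> dep_below k (opexp A t f).
Proof.
move=> Ak fk.
have it j : dep_below k (iter j A f) by elim: j => [|j IH] //=; exact: Ak.
move=> y yk s b; congr (limn (series _)).
by apply/funext => j; rewrite (it j y yk).
Qed.

(** Sites at level [k] or higher contribute zero because [f] ignores them; the constraints of the
    other sites look further down. *)
Lemma generator_dep k f : dep_below k f -> dep_below k (L f).
Proof.
move=> fk y yk s b; rewrite !generatorE; apply: eq_bigr => x _.
have [xk|xk] := leqP k (lev x).
  by rewrite !resample_id ?subrr ?mulr0//; exact: fk.
rewrite constraint_indep; last by exact: leq_trans (ltnW xk) yk.
by rewrite fk// (indep_resample x (fk y yk)).
Qed.

(* The generator of the chain killed at the legal rings of [x]. *)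
Definition killed_generator x f s : R := L f s - cstr x s * res x f s.

Local Notation K := killed_generator.

Lemma killed_linear x : linop (K x).
Proof.
by move=> c f g s; rewrite /killed_generator generator_linear resample_linear;
  ring.
Qed.

Lemma killed_pos x f : (forall s, 0 <= f s) ->
  forall s, 0 <= K x f s + N * f s.
Proof.
move=> f0 s; rewrite /killed_generator addrAC generator_shift (bigD1 x) //=.
rewrite addrAC; apply: addr_ge0.
  by rewrite addrAC subrr add0r mulr_ge0// subr_ge0; exact: constraint_le1.
by apply: sumr_ge0 => y _; exact: shift_term_ge0.
Qed.

Lemma killed_dep x f : dep_below (lev x) f -> dep_below (lev x) (K x f).
Proof.
move=> fk y yk s b; rewrite /killed_generator (generator_dep fk yk).
rewrite (constraint_indep yk).
by rewrite !(resample_id _ (fk x (leqnn _))) (fk y yk).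
Qed.

(** The two generators differ by [cstr x s * res x f s]. Under [L], zero conditional mean at [x]
    persists for functions of the levels up to that of [x], so all iterates agree. *)
Lemma killed_eq_semigroup x f (t : R) s :
  dep_below (lev x).+1 f -> (forall s, res x f s = 0) ->
  opexp L t f s = opexp (K x) t f s.
Proof.
move=> fk fx.
suff it j : [/\ dep_below (lev x).+1 (iter j L f),
    forall s, res x (iter j L f) s = 0 & iter j L f = iter j (K x) f].
  congr (limn (series _)); apply/funext => j.
  by have [_ _ ->] := it j.
elim: j => [//|j [jd jx je]]; split => /=.
- exact: generator_dep.
- move=> u.
  have -> : L (iter j L f) = fun s =>
     \sum_y 1 * (cstr y s * (res y (iter j L f) s - iter j L f s)).
    apply/funext => v; rewrite generatorE.
    by apply: eq_bigr => y _; rewrite mul1r.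
  rewrite (linop_sum (resample_linear x)) big1// => y _; rewrite mul1r.
  (* Above the level of [x] the increment vanishes; otherwise the constraint at [y] ignores [x], and
     [res x] commutes with [res y]. *)
  have [xy|yx] := ltnP (lev x) (lev y).
    rewrite (_ : (fun s => _) = fun=> 0) ?(linop0 (resample_linear x))//.
    by apply/funext => v; rewrite resample_id ?subrr ?mulr0//; exact: jd.
  rewrite resample_mull; last exact: constraint_indep.
  rewrite (linop_sub (resample_linear x)) jx resample_comm.
  rewrite (_ : res x _ = fun=> 0); last exact/funext.
  by rewrite (linop0 (resample_linear y)) subrr mulr0.
- rewrite -je; apply/funext => u.
  by rewrite /killed_generator jx mulr0 subr0.
Qed.

(** By Feynman-Kac, the probability of no legal ring at [x] up to time [t], as a function of the
    initial configuration. *)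
Definition survival x (t : R) : config d n -> R := opexp (K x) t (fun=> 1).

Lemma survival_dep x (t : R) : dep_below (lev x) (survival x t).
Proof. by apply: opexp_dep; [exact: killed_dep|move=> y _ s b]. Qed.

(** The difference [f - res x f] has zero conditional mean at [x], so it evolves by the killed
    semigroup, which is monotone; and it is at most 1. *)
Lemma semigroup_sub_resample x f (t : R) s : 0 <= t ->
  dep_below (lev x).+1 f -> (forall s, 0 <= f s <= 1) ->
  opexp L t f s <= opexp L t (res x f) s + survival x t s.
Proof.
move=> t0 fk f01.
rewrite -lerBlDl -(linop_sub (opexp_linop generator_linear t)).
have f0 u : 0 <= f u by case/andP: (f01 u).
have f1 u : f u <= 1 by case/andP: (f01 u).
rewrite (@killed_eq_semigroup x).
- apply: (opexp_le s (killed_linear x) (@killed_pos x) t0) => u.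
  by rewrite lerBlDr -[leLHS]addr0 lerD// (resample_ge0 p0 p1).
- move=> y yk u b; rewrite fk//; congr (_ - _).
  exact/indep_resample/fk.
- move=> u; rewrite (linop_sub (resample_linear x)).
  by rewrite (resample_id _ (resample_indep x f)) subrr.
Qed.

(** * Exponential decay of the mean survival probability *)

Section Survival.
Variables (lam a : R).
Hypotheses (lam0 : 0 < lam) (a0 : 0 < a) (a1 : a <= 1).
Hypothesis gap : forall f, lam * Defs.variance p f <=
  - mean p (fun s => f s * L f s).
Hypothesis mean_cstr : forall x, a <= mean p (cstr x).

Definition survival_rate : R := Num.min 1 (lam / 2) * a / 2.

(** Killing adds the mean of [cstr x s * f s ^+ 2] to the Dirichlet form. The gap controls the
    variance of [f]; the killing term controls its mean at the cost of some variance. *)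
Lemma killed_coercive x f : indep_of x f ->
  survival_rate * mean p (fun s => f s ^+ 2) <=
  - mean p (fun s => f s * K x f s).
Proof.
move=> fx.
have -> : - mean p (fun s => f s * K x f s) =
    - mean p (fun s => f s * L f s) + mean p (fun s => cstr x s * f s ^+ 2).
  rewrite -[X in _ = _ + X]opprK -opprD; congr (- _).
  rewrite -meanB; congr mean; apply/funext => s.
  by rewrite /killed_generator resample_id//; ring.
apply: le_trans (lerD (gap f) (lexx _)).
rewrite (_ : mean p (fun s => f s ^+ 2) =
   Defs.variance p f + mean p f ^+ 2); last by rewrite varianceE// subrK.
set v := Defs.variance p f; set m := mean p f.
have v0 : 0 <= v := variance_ge0 p0 p1 f.
rewrite /survival_rate; set th := Num.min _ _.
have th0 : 0 < th by rewrite lt_min ltr01 divr_gt0.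
have th1 : th <= 1 by rewrite ge_min lexx.
have thl : th <= lam / 2 by rewrite ge_min lexx orbT.
have ac := mean_cstr x.
set e := mean p (fun s => cstr x s * f s ^+ 2).
have e0 : 0 <= e.
  apply: mean_ge0 => // s; rewrite mulr_ge0 ?sqr_ge0//; exact: constraint_ge0.
have m0 : 0 <= m ^+ 2 := sqr_ge0 m.
(* This integrates [m ^+ 2 / 2 - (f s - m) ^+ 2 <= f s ^+ 2] against the constraint; the slack is an
   explicit sum of squares. *)
have eb : a * m ^+ 2 / 2 - v <= e.
  apply: (@le_trans _ _ (mean p (fun s =>
     m ^+ 2 / 2 * cstr x s - (f s - m) ^+ 2))).
    rewrite meanB meanZ lerB// -mulrA mulrC ler_wpM2l//.
    by rewrite divr_ge0.
  apply: mean_le => // s.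
  have c0 := constraint_ge0 x s; have c1 := constraint_le1 x s.
  have h1 : 0 <= cstr x s * (f s *+ 2 - m) ^+ 2 by rewrite mulr_ge0 ?sqr_ge0.
  have h2 : 0 <= (1 - cstr x s) * (f s - m) ^+ 2.
    by rewrite mulr_ge0 ?sqr_ge0// subr_ge0.
  rewrite -subr_ge0.
  have -> : cstr x s * f s ^+ 2 - (m ^+ 2 / 2 * cstr x s - (f s - m) ^+ 2) =
    cstr x s * (f s *+ 2 - m) ^+ 2 / 2 + (1 - cstr x s) * (f s - m) ^+ 2.
    by field.
  by rewrite addr_ge0// divr_ge0.
(* Using only the fraction [th] of the killing term keeps its variance cost within the gap:
   [th + th * a / 2 <= lam], since [th <= lam / 2] and [a <= 1]. *)
have h3 : th * (a * m ^+ 2 / 2 - v) <= e.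
  apply: (le_trans (y := th * e)); first by rewrite ler_wpM2l// ltW.
  by rewrite ler_piMl.
have h4 : 0 <= (lam - th - th * a / 2) * v.
  apply: mulr_ge0 => //.
  have := ler_wpM2l (ltW th0) a1; rewrite mulr1 => h; lra.
lra.
Qed.

(** Coercivity makes [phi], a rescaled squared L2 norm of the survival function, nonincreasing;
    nonnegativity of the variance then bounds the mean. *)
Lemma mean_survival_le x (t : R) : 0 <= t ->
  mean p (survival x t) <= expR (- (survival_rate * t)).
Proof.
move=> t0; set k := survival_rate.
pose u := survival x.
pose phi r := expR (2 * k * r) * mean p (fun s => u r s ^+ 2).
pose dphi r := expR (2 * k * r) *
   (2 * (k * mean p (fun s => u r s ^+ 2) +
         mean p (fun s => u r s * K x (u r) s))).
have dphiP r : is_derive r (1 : R) phi (dphi r).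
  have dm : is_derive r (1 : R) (fun r => mean p (fun s => u r s ^+ 2))
     (\sum_s eqm p s * (2 * (u r s * K x (u r) s))).
    apply: is_derive_fin_sum => s.
    have du : is_derive r (1 : R) (fun r => u r s) (K x (u r) s).
      rewrite /u /survival (opexp_comm (killed_linear x)).
      exact: opexp_derive (killed_linear x) _ _ _.
    by apply: is_derive_eq; rewrite /GRing.scale /=; ring.
  have dN : is_derive r (1 : R) (fun y : R => 2 * k * y) (2 * k).
    by apply: is_derive_eq; rewrite /GRing.scale /=; ring.
  have dE : is_derive r (1 : R) (fun r => expR (2 * k * r))
     (expR (2 * k * r) * (2 * k)).
    exact: (@is_derive1_comp R expR (fun y : R => 2 * k * y) r _ _
      (is_derive_expR (2 * k * r)) dN).
  apply: is_derive_eq; rewrite /GRing.scale /= /dphi.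
  have -> : \sum_s eqm p s * (2 * (u r s * K x (u r) s)) =
     2 * mean p (fun s => u r s * K x (u r) s).
    by rewrite -meanZ.
  by ring.
have phit : phi t <= phi 0.
  apply: (le_at0_of_derive_le0 dphiP t0) => r _.
  rewrite /dphi pmulr_rle0 ?expR_gt0// pmulr_rle0//.
  (* Orientation enters here: survival at [x] is a function of strictly lower levels. *)
  have ux : indep_of x (u r) by exact: survival_dep.
  by rewrite -lerBrDr sub0r killed_coercive.
have phi0 : phi 0 = 1.
  rewrite /phi mulr0 expR0 mul1r -[RHS](mean_cst (p := p) (n := n) (d := d)).
  congr mean; apply/funext => s.
  by rewrite /u /survival opexp_time0 expr1n.
have le1 : mean p (u t) ^+ 2 <= expR (- (k * t)) ^+ 2.
  apply: (@le_trans _ _ (mean p (fun s => u t s ^+ 2))).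
    by rewrite -subr_ge0 -varianceE//; exact: variance_ge0.
  rewrite expr2 -expRD -opprD -mulrDl -mulr2n -mulr_natl expRN.
  rewrite -div1r ler_pdivlMr ?expR_gt0// mulrC.
  by move: phit; rewrite phi0 /phi.
have ut0 : 0 <= mean p (u t).
  apply: mean_ge0 => // s.
  exact: (opexp_ge0 s (killed_linear x) (@killed_pos x) t0).
by rewrite -(@ler_pXn2r _ 2) // nnegrE ?expR_ge0.
Qed.

End Survival.

End OrientedGenerator.

(** * Relaxation layer by layer *)

Section Mixing.
Context {R : realType} {p : R} {d n : nat}.
Hypotheses (p0 : 0 < p) (p1 : p < 1).
Context {C : site d n -> {set site d n}}.
Hypothesis hC : constraining C.
Implicit Types (x y z : site d n) (s u : config d n) (f g : config d n -> R)
  (A : {set config d n}) (t : R).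

Local Notation L := (generator p C).
Local Notation P := (semigroup p C).
Local Notation res := (@resample R p d n).

Definition event A s : R := (s \in A)%:R.

Lemma event01 A s : 0 <= event A s <= 1.
Proof. by rewrite /event; case: (s \in A); rewrite ?lexx ?ler01. Qed.

Lemma mean_event A : mean p (event A) = \sum_(s in A) eqm p s.
Proof.
rewrite /mean [RHS]big_mkcond; apply: eq_bigr => s _; rewrite /event.
by case: (s \in A); rewrite ?mulr1 ?mulr0.
Qed.

Lemma semigroup_cst t (a : R) s : P t (fun=> a) s = a.
Proof.
apply: opexp_fix; last exact: generator_linear.
move=> u; rewrite generatorE// big1// => x _.
by rewrite resample_id ?subrr ?mulr0.
Qed.

Lemma semigroup_compl t f s : P t (fun s => 1 - f s) s = 1 - P t f s.
Proof.
rewrite -[X in X - _](semigroup_cst t 1 s).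
exact: (linop_sub (opexp_linop (generator_linear p0 p1) t) (fun=> 1) f s).
Qed.

Lemma semigroup_le t f g s : 0 <= t -> (forall s, f s <= g s) ->
  P t f s <= P t g s.
Proof.
exact: (opexp_le s (generator_linear p0 p1) (@generator_pos _ _ _ _ p0 p1 C)).
Qed.

Lemma semigroup01 t f s : 0 <= t -> (forall s, 0 <= f s <= 1) ->
  0 <= P t f s <= 1.
Proof.
move=> t0 f01; apply/andP; split.
  by rewrite -(semigroup_cst t 0 s) semigroup_le// => u; case/andP: (f01 u).
by rewrite -(semigroup_cst t 1 s) semigroup_le// => u; case/andP: (f01 u).
Qed.

Lemma mean_semigroup t f : mean p (P t f) = mean p f.
Proof.
apply: opexp_invariant; first exact: generator_linear.
exact: mean_generator.
Qed.

Lemma mean01 f : (forall s, 0 <= f s <= 1) -> 0 <= mean p f <= 1.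
Proof.
move=> f01; rewrite mean_ge0//=; last by move=> s; case/andP: (f01 s).
rewrite -[leRHS](mean_cst (p := p) (d := d) (n := n)) mean_le// => s.
by case/andP: (f01 s).
Qed.

Lemma law_at_event t nu A :
  \sum_(s in A) law_at p C t nu s = \sum_u nu u * P t (event A) u.
Proof.
rewrite /law_at exchange_big /=; apply: eq_bigr => u _.
rewrite -mulr_sumr; congr (_ * _).
have -> : event A = fun v => \sum_s event A s * delta_fun s v.
  exact: delta_expand.
rewrite [RHS](linop_sum (opexp_linop (generator_linear p0 p1) t)).
rewrite big_mkcond; apply: eq_bigr => s _; rewrite /event.
by case: (s \in A); rewrite ?mul1r ?mul0r.
Qed.

Lemma tv_dist_law_le t (eps : R) nu : 0 <= eps -> is_prob nu ->
  (forall A u, `|P t (event A) u - mean p (event A)| <= eps) ->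
  tv_dist (law_at p C t nu) (eqm p) <= eps.
Proof.
move=> eps0 [nu0 nu1] H; apply: bigmax_le => // A _.
rewrite law_at_event -mean_event.
rewrite -[X in _ - X]mul1r -nu1 mulr_suml -sumrB.
apply: (le_trans (ler_norm_sum _ _ _)).
rewrite -[leRHS]mul1r -nu1 mulr_suml; apply: ler_sum => u _.
by rewrite -mulrBr normrM ger0_norm// ler_wpM2l.
Qed.

Lemma worst_tv_le t (eps : R) : 0 <= eps ->
  (forall A u, `|P t (event A) u - mean p (event A)| <= eps) ->
  worst_tv p C t <= eps.
Proof.
move=> eps0 H; rewrite /worst_tv.
have [ne|/set0P/negP] := pselect ([set r | exists nu, is_prob nu /\
  r = tv_dist (law_at p C t nu) (eqm p)] !=set0).
  apply: ge_sup => // _ [nu [nuP ->]]; exact: tv_dist_law_le.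
(* The supremum of the empty set is 0 by convention, which [0 <= eps] covers. *)
by rewrite negbK => /eqP ->; rewrite sup0.
Qed.

(** The chain is started from the point mass at [u]. All distances are at most 1, so the real-valued
    [sup] is a genuine upper bound. *)
Lemma worst_tv_ge t A u : 0 <= t ->
  `|P t (event A) u - mean p (event A)| <= worst_tv p C t.
Proof.
move=> t0.
have nuP : is_prob (delta_fun u : config d n -> R).
  split=> [s|]; first by rewrite ler0n.
  rewrite (bigD1 u)//= /delta_fun eqxx big1 ?addr0// => s su.
  by rewrite (negPf su).
apply: le_trans (ub_le_sup _ _); last first.
- by exists (delta_fun u); split; [exact: nuP|reflexivity].
- exists 1 => _ [nu [nu1 ->]]; apply: tv_dist_law_le => // B v.
  have /andP[a0 a1] := semigroup01 v t0 (event01 B).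
  have /andP[b0 b1] := mean01 (event01 B).
  by rewrite ler_norml; apply/andP; split; lra.
rewrite /tv_dist.
have := le_bigmax 0 (fun B : {set config d n} =>
  `|\sum_(s in B) law_at p C t (delta_fun u) s -
    \sum_(s in B) eqm p s|) A.
rewrite law_at_event -mean_event; congr (`|_ - _| <= _).
rewrite (bigD1 u)//= /delta_fun eqxx mul1r big1 ?addr0// => s su.
by rewrite (negPf su) mul0r.
Qed.

Section Layers.
Variable tau : R.
Hypothesis tau0 : 0 <= tau.

Definition resample_all (l : seq (site d n)) f := foldr res f l.

Lemma resample_all_dep k l f : dep_below k f -> dep_below k (resample_all l f).
Proof.
move=> fk; elim: l => [//|x l IH] y yk /=.
exact: indep_resample (IH y yk).
Qed.

Lemma resample_all01 l f : (forall s, 0 <= f s <= 1) ->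
  forall s, 0 <= resample_all l f s <= 1.
Proof.
move=> f01; elim: l => [//|x l IH] s /=.
by rewrite resample_ge0 ?resample_le1// => u; case/andP: (IH u).
Qed.

Lemma mean_resample_all l f : mean p (resample_all l f) = mean p f.
Proof. by elim: l => [//|x l IH]; rewrite /= mean_resample. Qed.

Lemma resample_all_indep l x f : x \in l -> indep_of x (resample_all l f).
Proof.
elim: l => [//|y l IH]; rewrite inE => /orP[/eqP ->|/IH h] /=.
  exact: resample_indep.
exact: indep_resample h.
Qed.

Lemma semigroup_sub_layer k l f s : {in l, forall x, lev x = k} ->
  dep_below k.+1 f -> (forall s, 0 <= f s <= 1) ->
  P tau f s <= P tau (resample_all l f) s +
    \sum_(x <- l) survival (p := p) (C := C) x tau s.
Proof.
move=> lk fk f01; elim: l lk => [|x l IH] lk /=.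
  by rewrite big_nil addr0.
have xk : lev x = k by rewrite lk// mem_head.
apply: (le_trans (IH _)).
  by move=> y yl; apply: lk; rewrite inE yl orbT.
rewrite big_cons addrA lerD2r.
apply: semigroup_sub_resample => //; last exact: resample_all01.
by rewrite xk; exact: resample_all_dep.
Qed.

(** The sum runs over all sites, so that one quantity bounds the error of every layer. *)
Definition layer_error : R := \sum_x mean p (survival (p := p) (C := C) x tau).

(** The spins of [s] are replaced by those of [u] one site at a time. *)
Lemma dep_below0 f s u : dep_below 0 f -> f s = f u.
Proof.
move=> f0.
pose m (l : seq (site d n)) : config d n :=
  [ffun y => if y \in l then u y else s y].
have ml l : f (m l) = f s.
  elim: l => [|x l <-].
    by congr f; apply/ffunP => y; rewrite ffunE.
  rewrite -[RHS](f0 x (leq0n _) _ (u x)); congr f; apply/ffunP => y.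
  by rewrite updE !ffunE inE; case: eqVneq => [->|].
rewrite -(ml (enum (site d n))); congr f; apply/ffunP => y.
by rewrite ffunE mem_enum.
Qed.

(* One layer costs a time [tau]: since [P tau f] is dominated by a function [G]
   of the lower layers, the errors of the successive layers add up. *)
Lemma semigroup_layers k f s : dep_below k f -> (forall s, 0 <= f s <= 1) ->
  P (k%:R * tau) f s <= mean p f + k%:R * layer_error.
Proof.
elim: k f s => [|k IH] f s fk f01.
  rewrite !mul0r addr0 [leLHS]opexp_time0.
  rewrite -[leLHS](mean_cst (p := p) (d := d) (n := n)).
  by apply: mean_le => // u; rewrite (dep_below0 s u fk).
pose B := enum [pred x : site d n | lev x == k].
pose F := resample_all B f.
have BP : {in B, forall x, lev x = k}.
  by move=> x; rewrite mem_enum inE => /eqP.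
(* Level [k] has been averaged out, and [f] already ignored the levels above it. *)
have Fk : dep_below k F.
  move=> y yk; have [e|ne] := eqVneq (lev y) k.
    by apply: resample_all_indep; rewrite mem_enum inE e.
  have ky : (k < lev y)%N by rewrite ltn_neqAle eq_sym ne.
  exact: (resample_all_dep B fk ky).
pose E u : R := P tau F u + \sum_(x <- B) survival (p := p) (C := C) x tau u.
(* Truncating at 1 puts [G] in the range that the induction hypothesis requires. *)
pose G u : R := Num.min 1 (E u).
have surv0 x u : 0 <= survival (p := p) (C := C) x tau u.
  by apply: (opexp_ge0 u (killed_linear p0 p1 x)
    (@killed_pos _ _ _ _ p0 p1 C x)).
have F01 := resample_all01 B f01.
have G01 u : 0 <= G u <= 1.
  rewrite /G ge_min lexx le_min ler01 /= andbT addr_ge0//.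
    by case/andP: (semigroup01 u tau0 F01).
  by apply: sumr_ge0 => x _; exact: surv0.
have Gk : dep_below k G.
  move=> y yk u b; rewrite /G /E.
  have -> : P tau F (upd u y b) = P tau F u.
    exact: (opexp_dep tau (generator_dep p0 p1 hC (k := k)) Fk yk).
  congr (Num.min _ (_ + _)); rewrite !big_seq; apply: eq_bigr => x xB.
  by apply: (survival_dep p0 p1 hC); rewrite BP.
have fG u : P tau f u <= G u.
  rewrite le_min; case/andP: (semigroup01 u tau0 f01) => _ -> /=.
  exact: (semigroup_sub_layer u BP fk f01).
have -> : k.+1%:R * tau = k%:R * tau + tau by rewrite -natr1 mulrDl mul1r.
rewrite [leLHS](opexp_add _ _ _ _ (generator_linear p0 p1)).
apply: (@le_trans _ _ (P (k%:R * tau) G s)).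
  by apply: semigroup_le => //; rewrite mulr_ge0.
apply: (le_trans (IH G s Gk G01)).
rewrite -natr1 mulrDl mul1r [_ * _ + _]addrC addrA lerD2r.
(* By stationarity and invariance under resampling, [P tau F] has the mean of [f]; enlarging the
   error sum from [B] to all sites gives [layer_error]. *)
apply: (@le_trans _ _ (mean p E)).
  by apply: mean_le => // u; rewrite ge_min lexx orbT.
rewrite /E meanD mean_semigroup mean_resample_all lerD2l mean_sum /layer_error.
rewrite big_enum_cond [leRHS](bigID [pred x : site d n | lev x == k]) /=.
under eq_bigl do rewrite andbT.
rewrite lerDl.
by apply: sumr_ge0 => x _; exact: mean_ge0.
Qed.

(** The upper bound applied to [1 - f] is the lower bound for [f]. *)
Lemma semigroup_mixing k f s : (forall x, (lev x < k)%N) ->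
  (forall s, 0 <= f s <= 1) ->
  `|P (k%:R * tau) f s - mean p f| <= k%:R * layer_error.
Proof.
move=> levk f01.
have dep g : dep_below k g by move=> y; rewrite leqNgt levk.
have up := semigroup_layers s (dep f) f01.
have f01' u : 0 <= 1 - f u <= 1.
  by case/andP: (f01 u) => a b; rewrite subr_ge0 b lerBlDr lerDl.
have := semigroup_layers s (dep (fun u => 1 - f u)) f01'.
rewrite semigroup_compl meanB mean_cst => lo.
by rewrite ler_norml; apply/andP; split; lra.
Qed.

End Layers.

End Mixing.

(** * The mixing time from above *)

Lemma inf_nneg (R : realType) (S : set R) : lbound S 0 -> 0 <= inf S.
Proof.
move=> lb; have [|/set0P/negP] := pselect (S !=set0).
  by move=> ne; exact: lb_le_inf.
by rewrite negbK => /eqP ->; rewrite inf0.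
Qed.

Section Bounds.
Context {R : realType} {p : R} {d n : nat}.
Hypotheses (p0 : 0 < p) (p1 : p < 1).
Context {C : site d n -> {set site d n}}.
Hypothesis hC : constraining C.
Implicit Types (x y z : site d n) (s u : config d n) (f g : config d n -> R).

Local Notation L := (generator p C).
Local Notation P := (semigroup p C).

Lemma card_site : #|site d n| = (n ^ d)%N.
Proof. by rewrite card_ffun !card_ord. Qed.

(** A point of [Kstar x] is determined by the set of coordinates in which it differs from [x]. *)
Lemma card_Kstar_le x : (#|Kstar x| <= 2 ^ d)%N.
Proof.
pose h y : {ffun 'I_d -> bool} := [ffun i => y i != x i].
have -> : (2 ^ d)%N = #|{ffun 'I_d -> bool}|.
  by rewrite card_ffun card_bool card_ord.
rewrite -(card_in_imset (f := h)); first exact: max_card.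
have val_h y i : y \in Kstar x -> (y i = x i - h y i :> nat)%N.
  rewrite inE => /andP[_ /existsP[al /forallP yal]].
  rewrite /h ffunE -(inj_eq val_inj) /= -(eqP (yal i)).
  by case: (al i); rewrite ?addn1 ?addn0 ?eqxx ?subn0// neq_ltn ltnSn /= subn1.
move=> y z yK zK hyz; apply/ffunP => i; apply/val_inj => /=.
by rewrite (val_h y)// (val_h z)// hyz.
Qed.

Lemma mean_constraint_ge x : (1 - p) ^+ (2 ^ d) <= mean p (constraint C x).
Proof.
have q0 : 0 <= 1 - p by rewrite subr_ge0 ltW.
have q1 : 1 - p <= 1 by rewrite lerBlDr lerDl ltW.
have [xc|xc] := boolP (is_corner x).
  rewrite (_ : constraint C x = fun=> 1) ?mean_cst ?exprn_ile1//.
  by apply/funext => s; rewrite /constraint xc.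
rewrite (_ : constraint C x = fun s => \prod_(y in C x) (1 - (s y)%:R));
  last first.
  by apply/funext => s; rewrite /constraint (negPf xc).
rewrite (mean_prod_in (C x) (fun b => 1 - b%:R)) subrr mulr0 add0r subr0 mulr1.
apply: ler_wiXn2l => //; apply: leq_trans (card_Kstar_le x).
by apply: subset_leq_card; have := hC x; rewrite (negPf xc); case.
Qed.

Lemma spectral_gap_lbound :
  lbound [set r : R | exists f : config d n -> R, (exists s t, f s <> f t) /\
    r = - mean p (fun s => f s * L f s) / Defs.variance p f] 0.
Proof.
by move=> r [f [_ ->]]; rewrite divr_ge0 ?variance_ge0// dirichlet_ge0.
Qed.

Lemma spectral_gap_ge0 : 0 <= spectral_gap p C.
Proof.
exact: inf_nneg spectral_gap_lbound.
Qed.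

Lemma spectral_gap_variance f :
  spectral_gap p C * Defs.variance p f <= - mean p (fun s => f s * L f s).
Proof.
have := variance_ge0 p0 p1 f; rewrite le_eqVlt => /orP[/eqP <-|v0].
  by rewrite mulr0; exact: dirichlet_ge0.
rewrite -ler_pdivlMr//; apply: ge_inf.
  by exists 0; exact: spectral_gap_lbound.
exists f; split=> //; apply: contrapT => fc.
have fE s t : f s = f t.
  by apply: contrapT => ne; apply: fc; exists s, t.
move: v0; rewrite varianceE//.
have -> : f = fun=> f [ffun=> true] by apply/funext => s; exact: fE.
by rewrite !mean_cst// subrr ltxx.
Qed.

Section Upper.
Hypotheses (d0 : (0 < d)%N) (n2 : (2 <= n)%N).
Variable lam : R.
Hypotheses (lam0 : 0 < lam) (gap : lam <= spectral_gap p C).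

Local Notation rate := (survival_rate lam ((1 - p) ^+ (2 ^ d))).

Lemma survival_rate_gt0 : 0 < rate.
Proof.
by rewrite divr_gt0// mulr_gt0// ?exprn_gt0 ?subr_gt0// lt_min ltr01 divr_gt0.
Qed.

Lemma lev_lt x : (lev x < d * n)%N.
Proof.
rewrite /lev; apply: (@leq_ltn_trans (d * n.-1)).
  rewrite -[X in (X * _)%N]card_ord -sum_nat_const leq_sum// => i _.
  by rewrite -ltnS prednK ?ltn_ord// ltnW.
by rewrite ltn_pmul2l// prednK// ltnW.
Qed.

Lemma layer_error_le (tau : R) : 0 <= tau ->
  layer_error (p := p) (C := C) tau <= (n ^ d)%:R * expR (- (rate * tau)).
Proof.
move=> tau0; rewrite /layer_error -card_site mulr_natl.
rewrite -(eq_card (A := xpredT)) // -sumr_const; apply: ler_sum => x _.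
apply: mean_survival_le => //.
- by rewrite exprn_ile1// ?subr_ge0 ?lerBlDr ?lerDl ?ltW.
- move=> f; apply: le_trans (spectral_gap_variance f).
  by rewrite ler_wpM2r// variance_ge0.
- exact: mean_constraint_ge.
Qed.

(** There are [d * n] layers, each given time [tau = (2 * d + 4) / rate * ln n]. Each survival mean
    is then at most [n ^ -(2 * d + 4)], so the total error is at most
    [d * n * n ^ d / n ^ (2 * d + 4)]. *)
Lemma mixing_time_witness : worst_tv p C
   (d%:R * ((2 * d + 4)%:R / rate) * n%:R * ln n%:R) <= 1 / 4.
Proof.
have r0 := survival_rate_gt0.
have n0 : 0 < n%:R :> R by rewrite ltr0n ltnW.
have ln0 : 0 < ln n%:R :> R by rewrite ln_gt0// ltr1n.
set tau := (2 * d + 4)%:R / rate * ln n%:R.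
have tau0 : 0 <= tau.
  by apply: mulr_ge0; [apply: divr_ge0 => //|]; exact: ltW.
have -> : d%:R * ((2 * d + 4)%:R / rate) * n%:R * ln n%:R = (d * n)%:R * tau.
  by rewrite natrM /tau; ring.
apply: worst_tv_le => // A u.
apply: (le_trans (semigroup_mixing p0 p1 hC tau0 u lev_lt (event01 A))).
apply: (le_trans (ler_wpM2l (ler0n _ _) (layer_error_le tau0))).
have -> : rate * tau = (2 * d + 4)%:R * ln n%:R.
  by rewrite /tau mulrA mulrCA mulfV ?mulr1// gt_eqF.
rewrite -mulrN expRM_natl expRN lnK ?posrE// exprVn mulrA.
rewrite ler_pdivrMr ?exprn_gt0// mul1r [leRHS]mulrC.
rewrite ler_pdivlMr// -natrX -!natrM ler_nat.
(* The factor [n ^ (d + 1)] cancels, and [n ^ (d + 3)] absorbs [4 * d] through [d <= n ^ d] and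
   [4 <= n ^ 3]. *)
rewrite (_ : 2 * d + 4 = d + 1 + (d + 3))%N; last by lia.
have dn : (d <= n ^ d)%N := ltnW (ltn_expl d n2).
have n3 : (4 <= n ^ 3)%N by apply: (@leq_trans (2 ^ 3)); rewrite ?leq_exp2r.
rewrite [leqRHS]expnD [in leqRHS]expnD expn1 [(n ^ (d + 3))%N]expnD.
apply: (@leq_trans (n ^ d * n * (d * 4))); first by rewrite mulnA; lia.
by rewrite leq_mul2l leq_mul ?orbT.
Qed.

End Upper.
End Bounds.

(** * The mixing time from below *)

Section LowerBound.
Context {R : realType}.

Lemma expR1_le4 : expR 1 <= 4 :> R.
Proof.
have h : 1 / 2 <= expR (- (1 / 2)) :> R.
  by apply: le_trans (expR_ge1Dx _); lra.
have -> : expR 1 = (expR (- (1 / 2)) ^+ 2)^-1 :> R.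
  by rewrite expr2 -expRD -expRN; congr expR; lra.
rewrite invf_ple ?posrE ?exprn_gt0 ?expR_gt0//.
rewrite (_ : 4^-1 = (1 / 2) ^+ 2 :> R); last by field.
by rewrite lerXn2r ?nnegrE ?expR_ge0// divr_ge0.
Qed.

(** With [m = n - 1], one has [32 * t <= n / 2 <= m], so [(32 * t) ^ m / m!] is at most
    [expR m <= 4 ^ m]. Hence [t ^ m / m! <= 8 ^ -m], and [4 * n <= 8 ^ m]. *)
Lemma poisson_term_le (n : nat) (t : R) : (2 <= n)%N -> 0 <= t ->
  t <= n%:R / 64 -> n%:R * (t ^+ n.-1 / n.-1`!%:R) <= 1 / 4.
Proof.
case: n => [//|[//|k]] _ t0 tn.
rewrite /= -[k.+2]/(k.+1.+1); set m := k.+1 in tn *.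
have h1 : (32 * t) ^+ m / m`!%:R <= 4 ^+ m.
  apply: (@le_trans _ _ (expR (m%:R * 1))); last first.
    by rewrite expRM_natl lerXn2r ?nnegrE ?expR_ge0// expR1_le4.
  apply: (@le_trans _ _ (expR (32 * t))).
    apply: le_trans (expR_ge1Dxn k (mulr_ge0 (ler0n _ 32) t0)).
    by rewrite lerDr.
  rewrite ler_expR mulr1.
  have : (m.+1%:R : R) <= 2 * m%:R by rewrite -natrM ler_nat /m; lia.
  lra.
have h2 : t ^+ m / m`!%:R <= (8 ^+ m)^-1.
  rewrite -(@ler_pM2l _ (32 ^+ m)) ?exprn_gt0//.
  rewrite mulrA -exprMn; apply: (le_trans h1).
  by rewrite -exprVn -exprMn (_ : 32 * 8^-1 = 4 :> R)//; lra.
apply: (le_trans (ler_wpM2l (ler0n _ _) h2)).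
rewrite ler_pdivrMr ?exprn_gt0// mul1r [leRHS]mulrC ler_pdivlMr//.
rewrite -natrX -natrM ler_nat.
have : (m < 2 ^ m)%N by exact: ltn_expl.
have -> : 8%N = (2 ^ 3)%N by [].
rewrite -expnM [(3 * m)%N]mulnC expnM.
rewrite -[((2 ^ m) ^ 3)%N]/((2 ^ m) * ((2 ^ m) * (2 ^ m)))%N.
have : (2 <= 2 ^ m)%N by rewrite /m expnS leq_pmulr// expn_gt0.
by set w := (2 ^ m)%N => w2 mw; rewrite leq_mul// (leq_mul w2 w2).
Qed.

Context {p : R} {d n : nat}.
Hypotheses (p0 : 0 < p) (p1 : p < 1).
Context {C : site d n -> {set site d n}}.
Hypothesis hC : constraining C.
Implicit Types (x y z : site d n) (s u : config d n) (f g : config d n -> R)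
  (t : R).

Local Notation L := (generator p C).
Local Notation P := (semigroup p C).

Definition vacant x s : R := 1 - (s x)%:R.

Definition all_ones : config d n := [ffun=> true].
Definition all_zeros : config d n := [ffun=> false].

Lemma vacant01 x s : 0 <= vacant x s <= 1.
Proof. by rewrite /vacant; case: (s x); rewrite ?subrr ?subr0 ?lexx ?ler01. Qed.

(** Only the clock at [x] affects [vacant x]. Its constraint contains the factor [vacant y s], and
    the remaining factors are at most 1. *)
Lemma generator_vacant x y s : y \in C x -> L (vacant x) s <= vacant y s.
Proof.
move=> yC; rewrite generatorE// (bigD1 x)//= big1 ?addr0; last first.
  move=> z zx; rewrite resample_id ?subrr ?mulr0// => v b.
  by rewrite /vacant updE eq_sym (negPf zx).
have xc : is_corner x = false.
  by have := hC x; case: ifP => // _ Cx; rewrite Cx finset.in_set0 in yC.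
rewrite /constraint xc (bigD1 y)//= -/(vacant y s) -mulrA.
have /andP[v0 v1] := vacant01 y s.
rewrite ler_piMr//.
set w := \prod_(_ in _ | _) _.
have w0 : 0 <= w.
  by apply: prodr_ge0 => z _; have /andP[] := vacant01 z s.
have w1 : w <= 1.
  by apply: prodr_ile1 => z _; exact: (vacant01 z s).
have -> : resample (p := p) x (vacant x) s = 1 - p.
  by rewrite /resample /vacant !updE eqxx /=; ring.
have /andP[x0 x1] := vacant01 x s.
apply: (@le_trans _ _ (w * 1)); last by rewrite mulr1.
rewrite ler_wpM2l//.
by have := p0 => ?; lra.
Qed.

Lemma exists_predecessor x i j : (j.+1 <= x i)%N ->
  exists2 y, y \in C x & (j <= y i)%N.
Proof.
move=> jx; have xc : is_corner x = false.
  by apply/negbTE/forallP => /(_ i) /eqP xi; rewrite xi in jx.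
have := hC x; rewrite xc => -[/eqP /set0Pn[y yC] /fintype.subsetP sub].
exists y => //; have := sub y yC.
rewrite inE => /andP[_ /existsP[al /forallP h]]; move: jx.
by rewrite -(eqP (h i)); case: (al i); rewrite ?addn1 ?addn0// => /ltnW.
Qed.

(* [(d/dt) P t (vacant x) = P t (L (vacant x)) <= P t (vacant y)] with [y] in
   [C x], so each step away from the corner integrates the bound once more. *)
Lemma front_speed j x i t : (j <= x i)%N -> 0 <= t ->
  P t (vacant x) all_ones <= t ^+ j / j`!%:R.
Proof.
elim: j x t => [|j IH] x t jx t0.
  rewrite expr0 fact0 divr1.
  by have /andP[] := semigroup01 (C := C) p0 p1 all_ones t0 (vacant01 x).
have [y yC jy] := exists_predecessor jx.
pose f r : R := P r (vacant x) all_ones - r ^+ j.+1 / j.+1`!%:R.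
pose df r : R := P r (L (vacant x)) all_ones - r ^+ j / j`!%:R.
have fd r : is_derive r (1 : R) f (df r).
  have d1 : is_derive r (1 : R) (fun r => P r (vacant x) all_ones)
     (P r (L (vacant x)) all_ones).
    exact: opexp_derive (generator_linear p0 p1) _ _ _.
  have d2 : is_derive r (1 : R) (fun r : R => r ^+ j.+1) (j.+1%:R * r ^+ j).
    have -> : (fun r : R => r ^+ j.+1) = id ^+ j.+1.
      by apply/funext => z; rewrite exprfctE.
    by apply: is_derive_eq; rewrite /GRing.scale /= mulr1.
  apply: is_derive_eq; rewrite /df /GRing.scale /= factS natrM.
  have j0 : j.+1%:R != 0 :> R by rewrite pnatr_eq0.
  by rewrite !mulr0 add0r invfM mulrACA mulVf// mul1r [X in _ - X]mulrC.
have f0 : f 0 = 0.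
  rewrite /f expr0n mul0r subr0 [LHS]opexp_time0 /vacant ffunE; exact: subrr.
rewrite -subr_le0 -[leRHS]f0.
apply: (le_at0_of_derive_le0 fd t0) => r /andP[r0 _].
rewrite subr_le0; apply: le_trans (IH y r jy r0).
by apply: semigroup_le => // s; exact: generator_vacant.
Qed.

(** The event that [n] far sites are all ones has probability at least [3 / 4] from [all_ones],
    against [p ^+ n <= 1 / 4] in equilibrium. *)
Lemma worst_tv_gt_of_front t (i0 i1 : 'I_d) : i0 != i1 -> (2 <= n)%N ->
  p ^+ n <= 1 / 4 -> 0 <= t -> t <= n%:R / 64 -> 1 / 4 < worst_tv p C t.
Proof.
move=> i01 n2 pn t0 tn.
have n1 : (n.-1 < n)%N by rewrite ltn_predL ltnW.
(* Coordinate [i0] is maximal, which gives the front bound with exponent [n - 1]; the second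
   direction [i1] makes the [n] sites distinct. *)
pose e (k : 'I_n) : site d n := [ffun i => if i == i0 then Ordinal n1 else k].
have e_inj : injective e.
  move=> k l /ffunP /(_ i1); rewrite !ffunE eq_sym (negPf i01).
  by [].
pose A : {set config d n} := [set s : config d n | [forall k, s (e k)]]%SET.
have mA : mean p (event A) = p ^+ n.
  have -> : event A = fun s => \prod_(x in e @: 'I_n) (s x)%:R :> R.
    apply/funext => s; rewrite /event inE big_imset; last first.
      by move=> ? ? _ _; exact: e_inj.
    have [/forallP h|/forallPn [k nk]] := boolP [forall k, s (e k)].
      by rewrite big1// => k _; rewrite h.
    by rewrite (bigD1 k)//= (negPf nk) mul0r.
  rewrite (mean_prod_in _ (fun b => b%:R)) mulr1 mulr0 addr0.
  by rewrite card_imset// card_ord.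
(* Union bound: the indicator of [A] is at least one minus the number of vacant sites among the
   [e k]. *)
have low : 1 - n%:R * (t ^+ n.-1 / n.-1`!%:R) <= P t (event A) all_ones.
  apply: (@le_trans _ _
    (P t (fun s => 1 - \sum_k 1 * vacant (e k) s) all_ones)).
    rewrite semigroup_compl// lerB//.
    rewrite [leLHS](linop_sum (opexp_linop (generator_linear p0 p1) t)).
    rewrite -[X in X%:R * _](card_ord n) mulr_natl -sumr_const.
    apply: ler_sum => k _; rewrite mul1r.
    by apply: (front_speed (i := i0)) => //; rewrite ffunE eqxx.
  apply: semigroup_le => // s; rewrite /event inE.
  have v0 k : 0 <= 1 * vacant (e k) s.
    by rewrite mul1r; have /andP[] := vacant01 (e k) s.
  have [_|/forallPn [k nk]] := boolP [forall k, s (e k)].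
    by rewrite lerBlDr lerDl sumr_ge0.
  rewrite (bigD1 k)//= {1}/vacant (negPf nk) subr0 mulr1 opprD addrA subrr.
  by rewrite add0r oppr_le0 sumr_ge0.
have tail := poisson_term_le n2 t0 tn.
apply: lt_le_trans (worst_tv_ge p0 p1 A all_ones t0).
apply: lt_le_trans (ler_norm _).
by rewrite mA; lra.
Qed.

(** Clocks ring at total rate [n ^ d], so the chain is still at [all_zeros] with probability at
    least [expR (- (n ^ d * t)) >= 3 / 4]. *)
Lemma worst_tv_gt_of_exit t : (1 - p) ^+ (n ^ d) <= 1 / 4 ->
  0 <= t -> (n ^ d)%:R * t <= 1 / 4 -> 1 / 4 < worst_tv p C t.
Proof.
move=> qn t0 tn.
pose A : {set config d n} := [set all_zeros]%SET.
have mA : mean p (event A) = (1 - p) ^+ (n ^ d).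
  rewrite mean_event big_set1 /eqm.
  under eq_bigr do rewrite ffunE.
  by rewrite prodr_const -card_site; congr (_ ^+ _); exact: eq_card.
have low : 1 - (n ^ d)%:R * t <= P t (event A) all_zeros.
  have := opexp_lower_bound all_zeros (generator_linear p0 p1)
    (@generator_pos _ _ _ _ p0 p1 C) t0 (fun s => proj1 (andP (event01 A s))).
  rewrite {1}/event inE eqxx mulr1 card_site; apply: le_trans.
  exact: expR_ge1Dx.
apply: lt_le_trans (worst_tv_ge p0 p1 A all_zeros t0).
apply: lt_le_trans (ler_norm _).
by rewrite mA; lra.
Qed.

End LowerBound.

(** * Combination of the two bounds *)

Lemma exists_pow_le (R : realType) (p eps : R) : 0 <= p -> p < 1 -> 0 < eps ->
  exists m : nat, p ^+ m <= eps.
Proof.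
move=> p0 p1 e0.
have /cvgr0Pnorm_le /(_ eps e0) [m _ /(_ m (leqnn m)) h] :
  (fun k : nat => p ^+ k) @ \oo --> (0 : R).
  by apply: cvg_expr; rewrite ger0_norm.
by exists m; apply: le_trans h; rewrite ler_norm.
Qed.

Theorem theorem2p5 (R : realType) (d : nat) (hd : (2 <= d)%N)
    (p : R) (hp0 : 0 < p) (hp1 : p < 1)
    (C : forall n : nat, site d n -> {set site d n})
    (hC : forall n : nat, (1 <= n)%N -> constraining (C n))
    (hgap : 0 < inf [set r : R | exists n : nat,
                       (1 <= n)%N /\ r = spectral_gap p (C n)]) :
  exists c c' : R, 0 < c /\ 0 < c' /\
    forall n : nat, (2 <= n)%N ->
      c * n%:R <= mixing_time p (C n) /\
      mixing_time p (C n) <= c' * n%:R * ln n%:R.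
Proof.
set lam := inf _ in hgap.
have gap n : (1 <= n)%N -> lam <= spectral_gap p (C n).
  move=> n1; apply: ge_inf; last by exists n.
  by exists 0 => _ [m [m1 ->]]; apply: spectral_gap_ge0 => //; exact: hC.
have d0 : (0 < d)%N by exact: ltnW.
have [m pm] : exists m : nat, p ^+ m <= 1 / 4.
  by apply: exists_pow_le => //; rewrite ?ltW// divr_gt0.
pose rate := survival_rate lam ((1 - p) ^+ (2 ^ d)).
have rate0 : 0 < rate by exact: survival_rate_gt0.
(* This serves both cases: [c * n <= n / 64] always, and [n ^ d * (c * n) <= 1 / 64] when
   [n <= m]. *)
pose c : R := (64 * (m.+1 ^ d.+1)%:R)^-1.
pose c' : R := d%:R * ((2 * d + 4)%:R / rate).
have M1 : (1 <= (m.+1 ^ d.+1)%:R :> R) by rewrite ler1n expn_gt0.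
exists c, c'; split; first by rewrite invr_gt0 mulr_gt0// (lt_le_trans _ M1).
have c'0 : 0 < c'.
  apply: mulr_gt0; first by rewrite ltr0n.
  by apply: divr_gt0 => //; rewrite ltr0n addn_gt0 orbT.
split=> //.
move=> n n2; have n1 : (1 <= n)%N := ltnW n2.
have hCn := hC n n1.
set T := c' * n%:R * ln n%:R.
have T0 : 0 < T.
  apply: mulr_gt0; first by rewrite mulr_gt0 ?ltr0n.
  by rewrite ln_gt0// ltr1n.
have TP : 0 < T /\ worst_tv p (C n) T <= 1 / 4.
  by split=> //; exact: mixing_time_witness (gap n n1).
split; last by apply: ge_inf TP; exists 0 => t [/ltW].
apply: lb_le_inf; first by exists T.
(* A time [t] below [c * n] is excluded by showing that its worst distance still exceeds [1 / 4]. *)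
move=> t [/ltW t0]; have [//|/ltW tc] := leP (c * n%:R) t.
rewrite leNgt => /negP[].
have cM : c * (m.+1 ^ d.+1)%:R = 1 / 64.
  by rewrite /c; field; rewrite gt_eqF// (lt_le_trans _ M1).
have c0 : 0 <= c by rewrite invr_ge0 mulr_ge0.
have [pn|pn] := leP (p ^+ n) (1 / 4).
  apply: (@worst_tv_gt_of_front _ _ _ _ hp0 hp1 _ hCn _
    (Ordinal d0) (Ordinal hd)) => //.
  apply: (le_trans tc); rewrite mulrC ler_wpM2l//.
  by rewrite -[leRHS]mul1r -cM ler_peMr.
have nm : (n <= m)%N.
  rewrite leqNgt; apply/negP => /ltnW mn.
  have := ler_wiXn2l (ltW hp0) (ltW hp1) mn; lra.
(* Hence [1 / 2 < p], so [(1 - p) ^+ (n ^ d) <= (1 - p) ^+ 2 <= 1 / 4], as the exit bound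
   requires. *)
have p2 : 1 / 4 < p ^+ 2.
  by apply: (lt_le_trans pn); apply: ler_wiXn2l => //; exact: ltW.
apply: (worst_tv_gt_of_exit hp0 hp1) => //.
- have nd : (2 <= n ^ d)%N.
    by rewrite (leq_trans n2)// -[X in (X <= _)%N]expn1 leq_exp2l.
  have q0 : 0 <= 1 - p by lra.
  have q1 : 1 - p <= 1 by lra.
  apply: (le_trans (ler_wiXn2l q0 q1 nd)).
  nra.
- apply: (le_trans (ler_wpM2l (ler0n _ _) tc)).
  rewrite mulrCA -natrM -expnSr.
  apply: (@le_trans _ _ (c * (m.+1 ^ d.+1)%:R)); last by rewrite cM; lra.
  by rewrite ler_wpM2l// ler_nat leq_exp2r// (leq_trans nm).
Qed.
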